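(* Let $V_1,\dots,V_k$ be finite-dimensional complex vector spaces and let $t=f_1\otimes\cdots\otimes f_k$ with $f_i\in\operatorname{Sym}^{d_i}V_i$. Then $A_t\simeq A_{f_1}\otimes\cdots\otimes A_{f_k}$ as multigraded algebras. In particular, \[ \dim A_t=(\dim A_{f_1})\cdots(\dim A_{f_k}). \] Moreover, if $f_i^\perp$ is generated in degree at most $\delta_i$ for $i=1,\dots,k$, then $t^\perp$ is generated in multidegree at most $\boldsymbol\delta=(\delta_1,\dots,\delta_k)$.
   Context: The tensor $t\in\operatorname{Sym}^{d_1}V_1\otimes\cdots\otimes\operatorname{Sym}^{d_k}V_k$ is identified with a multihomogeneous polynomial in $\operatorname{Sym}^\bullet(V_1\oplus\cdots\oplus V_k)\simeq\operatorname{Sym}^\bullet V_1\otimes\cdots\otimes\operatorname{Sym}^\bullet V_k$ (the product of the $f_i$, in disjoint sets of variables), with the natural $\mathbb{N}^k$-grading. The ring $\operatorname{Sym}^\bullet(V_1^*\oplus\cdots\oplus V_k^* )$ acts on it as differential operators with constant coefficients (dual basis elements act as partial derivatives). The apolar ideal is $t^\perp=\{D\in\operatorname{Sym}^\bullet(V_1^*\oplus\cdots\oplus V_k^* ): D(t)=0\}$, a multihomogeneous ideal, and $A_t=\operatorname{Sym}^\bullet(V_1^*\oplus\cdots\oplus V_k^* )/t^\perp$ is the multigraded apolar algebra. Likewise, for each $i$, $f_i^\perp\subseteq\operatorname{Sym}^\bullet V_i^*$ and $A_{f_i}=\operatorname{Sym}^\bullet V_i^*/f_i^\perp$ (graded).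 The multidegree $\mathbf e=(e_1,\dots,e_k)$ component of $A_{f_1}\otimes\cdots\otimes A_{f_k}$ is $(A_{f_1})_{e_1}\otimes\cdots\otimes(A_{f_k})_{e_k}$. ''Generated in multidegree at most $\boldsymbol\delta$'' means generated by multihomogeneous elements whose multidegree is componentwise at most $\boldsymbol\delta$. *)

(* Defs.v *)
From HB Require Import structures.
From mathcomp Require Import all_boot all_order all_algebra.
From mathcomp Require Import ssrcomplements mpoly.

Set Implicit Arguments.
Unset Strict Implicit.
Unset Printing Implicit Defensive.

Import GRing.Theory.
Local Open Scope ring_scope.
Local Open Scope quotient_scope.

(* Finite-dimensional commutative algebras.  The zero algebra is allowed (it is
   the apolar algebra of 0), which rules out lalgType and algType: they require
   1 != 0. *)
Record fdComAlg (F : fieldType) := FdComAlg {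
  fd_sort :> vectType F;
  fd_one : fd_sort;
  fd_mul : fd_sort -> fd_sort -> fd_sort;
  fd_mulA : associative fd_mul;
  fd_mulC : commutative fd_mul;
  fd_mul1 : left_id fd_one fd_mul;
  fd_mul_linear : forall y, linear (fd_mul^~ y)
}.
Arguments fd_one {F} _.
Arguments fd_mul {F _} _ _.

Declare Scope fdalg_scope.
Delimit Scope fdalg_scope with FA.
Notation "x * y" := (fd_mul x y) : fdalg_scope.
Notation "1" := (fd_one _) : fdalg_scope.

Section IdealGeneration.
Variable S : comPzRingType.

Definition ideal_span (G : S -> Prop) (x : S) : Prop :=
  exists (r : nat) (c g : 'I_r -> S),
    (forall j, G (g j)) /\ x = \sum_(j < r) c j * g j.

Definition generated_within (I : {pred S}) (P : S -> Prop) : Prop :=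
  exists G : S -> Prop,
    (forall g, G g -> P g) /\ (forall x, x \in I <-> ideal_span G x).

End IdealGeneration.

Section Apolarity.
Variables (F : fieldType) (n : nat).
Implicit Types (D E p t : {mpoly F[n]}) (m : 'X_{1..n}).

Definition diffop D p : {mpoly F[n]} :=
  \sum_(m <- msupp D) D@_m *: p^`M[m].

Lemma diffopwE k D p : (msize D <= k)%N ->
  diffop D p = \sum_(m : 'X_{1..n < k}) D@_m *: p^`M[m].
Proof.
move=> le_Dk; rewrite /diffop (big_mksub 'X_{1..n < k}) //=; first last.
- by move=> m /msize_mdeg_lt /leq_trans; apply.
- exact/msupp_uniq.
rewrite big_rmcond //= => m /memN_msupp_eq0 ->.
by rewrite scale0r.
Qed.

Lemma diffop_linear p : linear (diffop^~ p).
Proof.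
move=> c D E; pose k := maxn (msize (c *: D + E)) (maxn (msize D) (msize E)).
have [h1 h2 h3]:
  [/\ (msize (c *: D + E) <= k)%N, (msize D <= k)%N & (msize E <= k)%N].
  by rewrite /k !leq_max !leqnn !orbT.
rewrite !(@diffopwE k) // scaler_sumr -big_split /=; apply: eq_bigr => m _.
by rewrite mcoeffD mcoeffZ scalerDl scalerA.
Qed.

Lemma diffop_linear_r D : linear (diffop D).
Proof.
move=> c p q; rewrite /diffop scaler_sumr -big_split /=; apply: eq_bigr => m _.
by rewrite linearP scalerDr !scalerA mulrC.
Qed.

HB.instance Definition _ D := GRing.isLinear.Build F {mpoly F[n]} {mpoly F[n]}
  _ (diffop D) (diffop_linear_r D).

Lemma diffop0l p : diffop 0 p = 0.
Proof. by rewrite /diffop msupp0 big_nil. Qed.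

Lemma diffopDl D E p : diffop (D + E) p = diffop D p + diffop E p.
Proof. by have := diffop_linear p 1 D E; rewrite !scale1r. Qed.

Lemma diffopZl c D p : diffop (c *: D) p = c *: diffop D p.
Proof. by have := diffop_linear p c D 0; rewrite addr0 diffop0l addr0. Qed.

Lemma diffopBl D E p : diffop (D - E) p = diffop D p - diffop E p.
Proof.
apply/eqP; rewrite eq_sym subr_eq -diffopDl; apply/eqP; congr (diffop _ p).
by rewrite subrK.
Qed.

Lemma diffop_suml (I : Type) (r : seq I) (P : pred I)
    (G : I -> {mpoly F[n]}) p :
  diffop (\sum_(i <- r | P i) G i) p = \sum_(i <- r | P i) diffop (G i) p.
Proof.
by apply: (big_morph (diffop^~ p)) => [D E|]; [apply: diffopDl | apply: diffop0l].
Qed.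

Lemma diffopXm m p : diffop 'X_[m] p = p^`M[m].
Proof. by rewrite /diffop msuppX big_seq1 mcoeffX eqxx scale1r. Qed.

Lemma diffopX i p : diffop 'X_i p = p^`M(i).
Proof. by rewrite diffopXm mderivmU1m. Qed.

Lemma diffop1 p : diffop 1 p = p.
Proof. by rewrite -mpolyX0 diffopXm mderivm0m. Qed.

Lemma diffopM D E p : diffop (D * E) p = diffop D (diffop E p).
Proof.
rewrite [D in LHS]mpolyE mulr_suml diffop_suml [RHS]/diffop.
apply: eq_bigr => m _; rewrite -scalerAl diffopZl; congr (_ *: _).
rewrite [E in LHS]mpolyE mulr_sumr diffop_suml [in RHS]/diffop linear_sum /=.
apply: eq_bigr => m' _; rewrite -scalerAr diffopZl linearZ /=; congr (_ *: _).
by rewrite -mpolyXD diffopXm addmC mderivmDm.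
Qed.

Lemma diffopC D E p : diffop D (diffop E p) = diffop E (diffop D p).
Proof. by rewrite -!diffopM mulrC. Qed.

Definition apolar t : pred {mpoly F[n]} := [pred D | diffop D t == 0].

Lemma apolar_zmod_closed t : zmod_closed (apolar t).
Proof.
split=> [|D E]; rewrite !inE ?diffop0l // => /eqP hD /eqP hE.
by rewrite diffopBl hD hE subr0.
Qed.

Definition apolar_ideal t : zmodClosed {mpoly F[n]} :=
  HB.pack (apolar t)
    (GRing.isZmodClosed.Build {mpoly F[n]} (apolar t) (apolar_zmod_closed t)).

Definition apolar_alg t : Type := Quotient.quot (apolar_ideal t).

HB.instance Definition _ t := GRing.Zmodule.on (apolar_alg t).

Definition apolar_class t D : apolar_alg t :=
  \pi_(Quotient.quot (apolar_ideal t)) D.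

Definition apolar_repr t (x : apolar_alg t) : {mpoly F[n]} :=
  @repr _ (Quotient.quot (apolar_ideal t)) x.

Section Algebra.
Variable t : {mpoly F[n]}.
Local Notation A := (apolar_alg t).
Local Notation cl := (apolar_class t).
Local Notation rp := (@apolar_repr t).

Lemma apolar_reprK : cancel rp cl.
Proof. exact: reprK. Qed.

Lemma apolar_class_eq D E : (cl D = cl E) <-> (diffop D t = diffop E t).
Proof.
have h: (cl D == cl E) = (diffop D t == diffop E t).
  rewrite [LHS]piE /= Quotient.equivE inE diffopBl.
  by rewrite subr_eq0.
by split=> /eqP; [rewrite h | rewrite -h] => /eqP.
Qed.

Lemma diffop_repr D : diffop (rp (cl D)) t = diffop D t.
Proof. by apply/apolar_class_eq; rewrite apolar_reprK. Qed.

Lemma apolar_classD D E : cl (D + E) = cl D + cl E.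
Proof. exact: pi_addr. Qed.

Definition apolar_scale (c : F) (x : A) : A := cl (c *: rp x).
Definition apolar_one : A := cl 1.
Definition apolar_mul (x y : A) : A := cl (rp x * rp y).

Lemma apolar_scaleE c D : apolar_scale c (cl D) = cl (c *: D).
Proof. by apply/apolar_class_eq; rewrite !diffopZl diffop_repr. Qed.

Lemma apolar_mulE D E : apolar_mul (cl D) (cl E) = cl (D * E).
Proof.
apply/apolar_class_eq.
by rewrite /apolar_mul diffopM diffop_repr diffopC diffop_repr diffopC diffopM.
Qed.

Lemma apolar_classP (x : A) : exists D, x = cl D.
Proof. by exists (rp x); rewrite apolar_reprK. Qed.

Lemma apolar_scaleA a b (x : A) :
  apolar_scale a (apolar_scale b x) = apolar_scale (a * b) x.
Proof. by have [D ->] := apolar_classP x; rewrite !apolar_scaleE scalerA. Qed.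
Lemma apolar_scale1 : left_id 1 apolar_scale.
Proof. by move=> x; have [D ->] := apolar_classP x; rewrite apolar_scaleE scale1r. Qed.
Lemma apolar_scaleDr : right_distributive apolar_scale +%R.
Proof.
move=> a x y; have [D ->] := apolar_classP x; have [E ->] := apolar_classP y.
by rewrite -apolar_classD !apolar_scaleE scalerDr apolar_classD.
Qed.
Lemma apolar_scaleDl (x : A) : {morph apolar_scale^~ x : a b / a + b}.
Proof.
move=> a b; have [D ->] := apolar_classP x.
by rewrite !apolar_scaleE scalerDl apolar_classD.
Qed.

HB.instance Definition _ := GRing.Zmodule_isLmodule.Build F A
  apolar_scaleA apolar_scale1 apolar_scaleDr apolar_scaleDl.

Lemma apolar_mulA : associative apolar_mul.
Proof.
move=> x y z; have [D ->] := apolar_classP x; have [E ->] := apolar_classP y.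
by have [G ->] := apolar_classP z; rewrite !apolar_mulE mulrA.
Qed.
Lemma apolar_mulC : commutative apolar_mul.
Proof. by move=> x y; rewrite /apolar_mul mulrC. Qed.
Lemma apolar_mul1 : left_id apolar_one apolar_mul.
Proof. by move=> x; have [D ->] := apolar_classP x; rewrite apolar_mulE mul1r. Qed.
Lemma apolar_mulDl : left_distributive apolar_mul +%R.
Proof.
move=> x y z; have [D ->] := apolar_classP x; have [E ->] := apolar_classP y.
have [G ->] := apolar_classP z.
by rewrite -apolar_classD !apolar_mulE mulrDl apolar_classD.
Qed.

Lemma apolar_classZ c D : cl (c *: D) = c *: cl D.
Proof. by rewrite -apolar_scaleE. Qed.
Lemma apolar_class_is_linear : linear cl.
Proof. by move=> c D E; rewrite apolar_classD apolar_classZ. Qed.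
HB.instance Definition _ :=
  GRing.isLinear.Build F {mpoly F[n]} A _ cl apolar_class_is_linear.

(* A is finite-dimensional: D |-> D(t) identifies A with a space of polynomials
   of bounded degree. *)
Let k := msize t.
Let B : finType := 'X_{1..n < k}.
Let co (p : {mpoly F[n]}) : 'rV[F]_#|B| := \row_j p@_(enum_val j : B).
Let g (v : 'rV[F]_#|B|) : {mpoly F[n]} := \sum_j v 0 j *: 'X_[(enum_val j : B)].

Let coP c p q : co (c *: p + q) = c *: co p + co q.
Proof. by apply/rowP => j; rewrite !mxE mcoeffD mcoeffZ. Qed.

Let mderivm_big m : (k <= mdeg m)%N -> t^`M[m] = 0.
Proof.
move=> h; apply/mpolyP => m'; rewrite mcoeff_mderivm mcoeff0 memN_msupp_eq0 ?mul0rn //.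
by apply: msize_mdeg_ge; rewrite mdegD (leq_trans h) // leq_addr.
Qed.

Let mcoeff_diffop D m : (k <= mdeg m)%N -> (diffop D t)@_m = 0.
Proof.
move=> h; rewrite /diffop raddf_sum /= big1 // => m' _.
rewrite mcoeffZ mcoeff_mderivm [t@__]memN_msupp_eq0 ?mul0rn ?mulr0 //.
by apply: msize_mdeg_ge; rewrite mdegD (leq_trans h) // leq_addl.
Qed.

Let co_inj D E : co (diffop D t) = co (diffop E t) -> diffop D t = diffop E t.
Proof.
move=> h; apply/mpolyP => m; case: (ltnP (mdeg m) k) => hm; last first.
  by rewrite !mcoeff_diffop.
by move/rowP/(_ (enum_rank (BMultinom hm))): h; rewrite !mxE enum_rankK.
Qed.

Let M : 'M[F]_#|B| := \matrix_i co (t^`M[(enum_val i : B)]).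

Let co_g v : co (diffop (g v) t) = v *m M.
Proof.
rewrite /g diffop_suml mulmx_sum_row.
have co0 : co 0 = 0 by apply/rowP => j; rewrite !mxE mcoeff0.
have coD p q : co (p + q) = co p + co q by rewrite -[p]scale1r coP !scale1r.
rewrite (big_morph co coD co0); apply: eq_bigr => j _.
by rewrite diffopZl diffopXm -[_ *: _]addr0 coP co0 addr0 rowK.
Qed.

Let co_sub D : (co (diffop D t) <= M)%MS.
Proof.
have co0 : co 0 = 0 by apply/rowP => j; rewrite !mxE mcoeff0.
have coD p q : co (p + q) = co p + co q by rewrite -[p]scale1r coP !scale1r.
rewrite /diffop (big_morph co coD co0); apply: summx_sub => m _.
rewrite -[_ *: _]addr0 coP co0 addr0; apply: scalemx_sub.
case: (ltnP (mdeg m) k) => hm; last by rewrite mderivm_big // co0 sub0mx.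
have -> : co t^`M[m] = row (enum_rank (BMultinom hm)) M.
  by rewrite rowK enum_rankK.
exact: row_sub.
Qed.

Fact apolar_vect_iso : Vector.axiom (\rank M) A.
Proof.
pose r := row_base M.
pose f (x : A) := co (diffop (rp x) t) *m pinvmx r.
pose h (w : 'rV[F]_(\rank M)) := cl (g (w *m r *m pinvmx M)).
have rM : (r <= M)%MS by rewrite eq_row_base.
exists f.
  move=> c x y; have [D ->] := apolar_classP x; have [E ->] := apolar_classP y.
  rewrite /f -apolar_classZ -apolar_classD !diffop_repr diffopDl diffopZl coP.
  by rewrite mulmxDl scalemxAl.
exists h => [x|w].
  rewrite /h /f mulmxKpV ?eq_row_base ?co_sub //.
  rewrite -[RHS]apolar_reprK; apply/apolar_class_eq/co_inj.
  by rewrite co_g mulmxKpV ?co_sub.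
rewrite /f /h diffop_repr co_g mulmxKpV; first by rewrite mulmxKp ?row_base_free.
exact: submx_trans (submxMl _ _) rM.
Qed.

HB.instance Definition _ := Lmodule_hasFinDim.Build F A apolar_vect_iso.

Lemma apolar_mul_linear (y : A) : linear (apolar_mul^~ y).
Proof.
move=> c x z; have [D ->] := apolar_classP x; have [E ->] := apolar_classP y.
have [G ->] := apolar_classP z.
rewrite -apolar_classZ -apolar_classD !apolar_mulE mulrDl -scalerAl.
by rewrite apolar_classD apolar_classZ.
Qed.

Definition apolar_algebra : fdComAlg F :=
  @FdComAlg F A apolar_one apolar_mul
    apolar_mulA apolar_mulC apolar_mul1 apolar_mul_linear.

End Algebra.
End Apolarity.

Section Tensor.
Variables (F : fieldType) (I : finType) (A : I -> fdComAlg F).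

Local Notation d i := (\dim {: A i}).
Local Notation b i := (vbasis {: A i}).

(* The tensor product in coordinates: x p is the coefficient of the tensor
   product of the basis vectors (b i)`_(p i), see tensor_expand. *)
Definition tensor_index := fprod (fun i => 'I_(d i)).
Definition tensor : Type := {ffun tensor_index -> F^o}.
HB.instance Definition _ := Vector.on tensor.

Implicit Types (p q r : tensor_index) (a : forall i, A i) (x y z : tensor).

Definition pure_tensor a : tensor :=
  [ffun p : tensor_index => \prod_i coord (b i) (p i) (a i)].

Definition basis_vec p i : A i := (b i)`_(p i).

(* The bilinear map such that pure tensors multiply factor by factor, see
   pure_tensorM. *)
Definition tensor_mul x y : tensor :=
  \sum_p \sum_q (x p * y q) *:
    pure_tensor (fun i => (basis_vec p i * basis_vec q i)%FA).
Definition tensor_one : tensor := pure_tensor (fun i => 1%FA).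

Lemma coord_basis i (j l : 'I_(d i)) : coord (b i) j (b i)`_l = (l == j)%:R.
Proof. exact: coord_free (basis_free (vbasisP _)). Qed.

Lemma basis_expand i (u : A i) : u = \sum_j coord (b i) j u *: (b i)`_j.
Proof. exact: (coord_vbasis (memvf u)). Qed.

Lemma pure_tensor_basis p : pure_tensor (basis_vec p) = [ffun q => (p == q)%:R].
Proof.
apply/ffunP => q; rewrite !ffunE; case: eqP => [<-|/eqP ne].
  by rewrite big1 // => i _; rewrite coord_basis eqxx.
have [i hi]: exists i, q i != p i.
  apply/existsP; rewrite -negb_forall; apply: contraNN ne => /forallP h.
  by apply/eqP/fprodP => i; apply/esym/eqP.
by rewrite (bigD1 i) //= coord_basis eq_sym (negbTE hi) mul0r.
Qed.

Lemma tensor_expand x : x = \sum_p x p *: pure_tensor (basis_vec p).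
Proof.
apply/ffunP => q; rewrite sum_ffunE (bigD1 q) //= big1 => [|p ne].
  by rewrite addr0 ffunE pure_tensor_basis ffunE eqxx; exact/esym/mulr1.
by rewrite ffunE pure_tensor_basis ffunE (negbTE ne); exact: mulr0.
Qed.

Lemma eq_pure_tensor a a' :
  (forall i, a i = a' i) -> pure_tensor a = pure_tensor a'.
Proof.
move=> h; apply/ffunP => p; rewrite !ffunE.
by apply: eq_bigr => i _; rewrite h.
Qed.

Lemma pure_tensor_linear a i : linear (fun u : A i => pure_tensor (dfwith a u)).
Proof.
move=> c u v; apply/ffunP => p.
have E w : pure_tensor (dfwith a w) p =
    coord (b i) (p i) w * \prod_(j | j != i) coord (b j) (p j) (a j).
  rewrite ffunE (bigD1 i) //= dfwith_in; congr (_ * _).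
  by apply: eq_bigr => j ne; rewrite dfwith_out // eq_sym.
by rewrite [RHS]ffunE [X in _ = X + _]ffunE !E linearP mulrDl -mulrA.
Qed.

Lemma tensor_distr (G : forall i, 'I_(d i) -> F) :
  \prod_i \sum_j G i j = \sum_(p : tensor_index) \prod_i G i (p i).
Proof.
pose P i := [ffun j => G i j].
transitivity (\prod_i \sum_j P i j).
  by apply: eq_bigr => i _; apply: eq_bigr => j _; rewrite ffunE.
rewrite (eq_bigr _ (fun i _ => big_tag (fun i => P i) i)).
rewrite bigA_distr_big_dep -big_fprod.
by apply: eq_bigr => p _; apply: eq_bigr => i _; rewrite ffunE.
Qed.

Lemma tensor_mul_linear y : linear (tensor_mul^~ y).
Proof.
move=> c x z; rewrite /tensor_mul scaler_sumr -big_split /=; apply: eq_bigr => p _.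
rewrite scaler_sumr -big_split /=; apply: eq_bigr => q _.
by rewrite !ffunE scalerA -scalerDl mulrDl mulrA.
Qed.

Lemma fd_mulC_sum i (u v : A i) : (u * v)%FA =
  \sum_j \sum_l (coord (b i) j u * coord (b i) l v) *: ((b i)`_j * (b i)`_l)%FA.
Proof.
have lin (w : A i) : linear (fun u => u * w)%FA := fd_mul_linear w.
have sumZ (w : A i) (n : nat) (c : 'I_n -> F) (B : 'I_n -> A i) :
    ((\sum_j c j *: B j) * w)%FA = \sum_j c j *: (B j * w)%FA.
  have h0 : (0 * w)%FA = 0.
    by have /= := lin w (-1) 0 0; rewrite scaler0 addr0 scaleN1r addNr.
  have hD (x1 x2 : A i) : ((x1 + x2)%R * w)%FA = (x1 * w)%FA + (x2 * w)%FA.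
    by have /= := lin w 1 x1 x2; rewrite !scale1r.
  rewrite (big_morph _ hD h0); apply: eq_bigr => j _.
  by have /= := lin w (c j) (B j) 0; rewrite !addr0 h0 addr0.
rewrite {1}(basis_expand u) sumZ; apply: eq_bigr => j _.
rewrite fd_mulC {1}(basis_expand v) sumZ scaler_sumr; apply: eq_bigr => l _.
by rewrite scalerA fd_mulC.
Qed.

Lemma pure_tensorM a a' :
  tensor_mul (pure_tensor a) (pure_tensor a') =
    pure_tensor (fun i => a i * a' i)%FA.
Proof.
apply/ffunP => r; rewrite [RHS]ffunE.
pose G i j l := coord (b i) j (a i) * coord (b i) l (a' i) *
  coord (b i) (r i) ((b i)`_j * (b i)`_l)%FA.
transitivity (\prod_i \sum_j \sum_l G i j l); last first.
  apply: eq_bigr => i _; rewrite fd_mulC_sum linear_sum; apply: eq_bigr => j _.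
  by rewrite linear_sum; apply: eq_bigr => l _; rewrite linearZ.
rewrite (tensor_distr (fun i j => \sum_l G i j l)) sum_ffunE; apply: eq_bigr => p _.
rewrite (tensor_distr (fun i l => G i (p i) l)) sum_ffunE; apply: eq_bigr => q _.
by rewrite !ffunE /G !big_split.
Qed.

Lemma tensor_mulC : commutative tensor_mul.
Proof.
move=> x y; rewrite /tensor_mul exchange_big /=.
apply: eq_bigr => q _; apply: eq_bigr => p _; rewrite mulrC; congr (_ *: _).
by apply: eq_pure_tensor => i; rewrite fd_mulC.
Qed.

Lemma tensor_ind (f g : tensor -> tensor) : linear f -> linear g ->
  (forall a, f (pure_tensor a) = g (pure_tensor a)) -> f =1 g.
Proof.
move=> lf lg h x.
pose fM := GRing.isLinear.Build F tensor tensor _ f lf.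
pose gM := GRing.isLinear.Build F tensor tensor _ g lg.
pose fL : {linear tensor -> tensor} := HB.pack f fM.
pose gL : {linear tensor -> tensor} := HB.pack g gM.
rewrite (tensor_expand x) -[f]/(fL : _ -> _) -[g]/(gL : _ -> _) !linear_sum.
by apply: eq_bigr => p _; rewrite !linearZ /= h.
Qed.

Lemma tensor_mul1 : left_id tensor_one tensor_mul.
Proof.
apply: (tensor_ind (f := tensor_mul tensor_one)) => [c x y|c x y|a] //.
  by rewrite ![tensor_mul tensor_one _]tensor_mulC tensor_mul_linear.
by rewrite pure_tensorM; apply: eq_pure_tensor => i; rewrite fd_mul1.
Qed.

Lemma tensor_mulA : associative tensor_mul.
Proof.
have lr x : linear (tensor_mul x).
  by move=> c u v; rewrite ![tensor_mul x _]tensor_mulC tensor_mul_linear.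
have ll := tensor_mul_linear.
move=> x y z; move: x.
apply: tensor_ind => [c u v|c u v|a]; rewrite ?ll //; move: y.
apply: tensor_ind => [c u v|c u v|a']; rewrite ?(ll, lr) //; move: z.
apply: tensor_ind => [c u v|c u v|a'']; rewrite ?(ll, lr) //.
by rewrite !pure_tensorM; apply: eq_pure_tensor => i; rewrite fd_mulA.
Qed.

Definition tensor_algebra : fdComAlg F :=
  @FdComAlg F tensor tensor_one tensor_mul
    tensor_mulA tensor_mulC tensor_mul1 tensor_mul_linear.

(* The image in the tensor product of the tensor product of subspaces G i. *)
Definition tensor_piece (G : forall i, A i -> Prop) (x : tensor_algebra) :
  Prop :=
  exists (r : nat) (c : 'I_r -> F) (a : 'I_r -> forall i, A i),
    (forall j i, G i (a j i)) /\ x = \sum_(j < r) c j *: pure_tensor (a j).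

End Tensor.

(* Sym V in coordinates: 'X_j is the j-th vector of vbasis {:V}.  The same ring,
   with 'X_j the j-th vector of the dual basis, stands for Sym V^*, acting on
   Sym V through diffop. *)
Definition Sym (F : fieldType) (V : vectType F) : Type := {mpoly F[\dim {: V}]}.

Section Multigraded.
Variables (F : fieldType) (k : nat) (n : 'I_k -> nat).

(* Sym (V_1 + ... + V_k), with dim V_i = n i: the j-th variable of the i-th
   block is 'X_(tagnat.Rank i j). *)
Local Notation S := {mpoly F[\sum_i n i]}.

Definition block_deg (m : 'X_{1..\sum_i n i}) (i : 'I_k) : nat :=
  (\sum_(j < n i) m (tagnat.Rank i j))%N.

Definition multihomog (e : 'I_k -> nat) (D : S) : Prop :=
  forall m, m \in msupp D -> forall i, block_deg m i = e i.

Definition block_inj (i : 'I_k) (p : {mpoly F[n i]}) : S :=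
  p \mPo [tuple 'X_(tagnat.Rank i j) | j < n i].

Definition tensor_poly (f : forall i, {mpoly F[n i]}) : S :=
  \prod_i block_inj (f i).

Definition multideg_le (delta : 'I_k -> nat) (D : S) : Prop :=
  exists e : 'I_k -> nat, (forall i, e i <= delta i)%N /\ multihomog e D.

Definition apolar_multipiece (t : S) (e : 'I_k -> nat) (x : apolar_algebra t) :
  Prop :=
  exists D, multihomog e D /\ x = apolar_class t D.

End Multigraded.
Arguments apolar_multipiece {F k n} t e x.

Definition deg_le (F : fieldType) (n delta : nat) (D : {mpoly F[n]}) : Prop :=
  exists e, (e <= delta)%N /\ D \is e.-homog.

Definition apolar_piece (F : fieldType) (n : nat) (t : {mpoly F[n]}) (e : nat)
    (x : apolar_algebra t) : Prop :=
  exists D, D \is e.-homog /\ x = apolar_class t D.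

Arguments apolar_piece {F n} t e x.

(* pA and pB give the homogeneous components of A and B. *)
Definition graded_alg_iso (F : fieldType) (E : Type) (A B : fdComAlg F)
    (pA : E -> A -> Prop) (pB : E -> B -> Prop) (phi : {linear A -> B}) :
  Prop :=
  [/\ bijective phi,
      phi 1%FA = 1%FA,
      forall x y, phi (x * y)%FA = (phi x * phi y)%FA
    & forall e x, pA e x <-> pB e (phi x)].

(* Main.v *)
From HB Require Import structures.
Require Import Defs.
From mathcomp Require Import all_boot all_order all_algebra.
From mathcomp Require Import reals complex mpoly.

Set Implicit Arguments.
Unset Strict Implicit.
Unset Printing Implicit Defensive.
Local Open Scope ring_scope.
Import GRing.Theory.

(** Write S_i for Sym V_i^* and S for the polynomial ring in all the variables,
    which is the tensor product of the S_i.

    Everything rests on the fact that, in disjoint sets of variables,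
    differential operators act factor by factor:
    (D_1 ... D_k) (f_1 ... f_k) = D_1(f_1) ... D_k(f_k)
    ([diffop_tensor_poly]).  The map D |-> D(f_i) identifies A_{f_i} with the
    space of partial derivatives of f_i, and likewise for t, so this equation
    makes D_1 (x) ... (x) D_k |-> D_1 ... D_k a well-defined algebra morphism
    [of_tensor] from the tensor product of the A_{f_i} to A_t.

    It is injective because products of linearly independent families of
    polynomials in disjoint sets of variables are linearly independent
    ([tensor_poly_free]): the coefficient of a monomial in such a product is
    the product of the coefficients of its blocks, so functionals dual to the
    given families multiply to functionals dual to the family of products.

    It is surjective because a monomial is the product of its blocks.  More
    precisely, every D in S is congruent to a lift of an element
    [tensor_class D] of the tensor product, modulo any ideal J that contains
    the f_i^perp ([sub_lift_tensor_class]).  Taking J = t^perp gives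
    surjectivity.  Taking for J the ideal generated by the f_i^perp gives the
    statement on generators: if D(t) = 0, then [tensor_class D] is sent to 0,
    so it is 0 by injectivity, and D is in J.  Hence t^perp is generated by the
    f_i^perp, and a generator of degree e of f_i^perp has multidegree
    (0, ..., e, ..., 0).

    Products of homogeneous D_i are multihomogeneous and monomials are products
    of homogeneous ones, so the isomorphism respects the multigradings. *)

(** * Products of sums and ideals *)

Lemma prod_sum_fprod (R : comNzRingType) (I : finType) (T : I -> finType)
    (G : forall i, T i -> R) :
  \prod_i \sum_(j : T i) G i j = \sum_(p : fprod T) \prod_i G i (p i).
Proof.
pose P i := [ffun j => G i j].
transitivity (\prod_i \sum_j P i j).
  by apply: eq_bigr => i _; apply: eq_bigr => j _; rewrite ffunE.
rewrite (eq_bigr _ (fun i _ => big_tag (fun i => P i) i)).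
rewrite bigA_distr_big_dep -big_fprod.
by apply: eq_bigr => p _; apply: eq_bigr => i _; rewrite ffunE.
Qed.

Section Ideals.
Variable S : comPzRingType.

(** Ideals are Prop-valued so that ideals given by generators, whose
    membership is not decidable, are covered along with apolar ideals. *)
Definition is_ideal (J : S -> Prop) : Prop :=
  [/\ J 0, forall x y, J x -> J y -> J (x + y) & forall c x, J x -> J (c * x)].

Lemma ideal_span_is_ideal (G : S -> Prop) : is_ideal (ideal_span G).
Proof.
split=> [|x y [r1 [c1 [g1 [G1 ->]]]] [r2 [c2 [g2 [G2 ->]]]]
        |a x [r [c [g [Gg ->]]]]].
- exists 0%N, (fun=> 0), (fun=> 0); split=> [[] //|].
  by rewrite big_ord0.
- pose glue (u1 : 'I_r1 -> S) (u2 : 'I_r2 -> S) j :=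
    match split j with inl j1 => u1 j1 | inr j2 => u2 j2 end.
  exists (r1 + r2)%N, (glue c1 c2), (glue g1 g2); split=> [j|].
    by rewrite /glue; case: split.
  rewrite big_split_ord /glue; congr (_ + _); apply: eq_bigr => j _.
    by rewrite (unsplitK (inl j)).
  by rewrite (unsplitK (inr j)).
exists r, (fun j => a * c j), g; split=> //.
by rewrite mulr_sumr; apply: eq_bigr => j _; rewrite mulrA.
Qed.

Lemma ideal_span_gen (G : S -> Prop) x : G x -> ideal_span G x.
Proof.
by move=> Gx; exists 1%N, (fun=> 1), (fun=> x); rewrite big_ord1 mul1r.
Qed.

Lemma ideal_sum (J : S -> Prop) (T : Type) (r : seq T) (P : pred T)
    (E : T -> S) :
  is_ideal J -> (forall i, P i -> J (E i)) -> J (\sum_(i <- r | P i) E i).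
Proof. by case=> J0 JD _ JE; apply: big_ind. Qed.

Lemma ideal_span_min (G J : S -> Prop) :
  is_ideal J -> (forall g, G g -> J g) -> forall x, ideal_span G x -> J x.
Proof.
move=> idJ GJ x [r [c [g [Gg ->]]]]; apply: ideal_sum => // j _.
by have [_ _ JM] := idJ; apply/JM/GJ/Gg.
Qed.

(** Multiplication is well defined modulo an ideal: replace the factors one at
    a time. *)
Lemma ideal_prod_sub (J : S -> Prop) (I : finType) (a b : I -> S) :
  is_ideal J -> (forall i, J (a i - b i)) -> J (\prod_i a i - \prod_i b i).
Proof.
case=> J0 JD JM h; elim/big_rec2: _ => [|i x y _ IH]; first by rewrite subrr.
have ->: a i * y - b i * x = y * (a i - b i) + b i * (y - x).
  by rewrite !mulrBr ![y * _]mulrC [in RHS]addrA subrK.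
by apply: (JD _ _ (JM _ _ (h i)) (JM _ _ IH)).
Qed.

End Ideals.

(** * Monomials in blocks of variables *)

Section Blocks.
Variables (k : nat) (n : 'I_k -> nat).
Implicit Types (mu : forall i, 'X_{1..n i}) (m : 'X_{1..\sum_i n i}).

Definition slice m (i : 'I_k) : 'X_{1..n i} :=
  [multinom m (tagnat.Rank i j) | j < n i].

Definition glue mu : 'X_{1..\sum_i n i} :=
  [multinom mu _ (tagged (tagnat.sig s)) | s < \sum_i n i].

Lemma glue_Rank mu i j : glue mu (tagnat.Rank i j) = mu i j.
Proof. by rewrite mnmE /tagnat.Rank tagnat.rankK. Qed.

Lemma glueK mu i : slice (glue mu) i = mu i.
Proof. by apply/mnmP => j; rewrite mnmE glue_Rank. Qed.

Lemma sliceK m : glue (slice m) = m.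
Proof.
apply/mnmP => s; rewrite -[s]tagnat.sigK tagnat.rankE.
by rewrite glue_Rank mnmE.
Qed.

Lemma sliceD m1 m2 i : slice (m1 + m2) i = (slice m1 i + slice m2 i)%MM.
Proof. by apply/mnmP => j; rewrite !(mnmE, mnmDE). Qed.

Lemma mdeg_slice m i : mdeg (slice m i) = block_deg m i.
Proof. by rewrite mdegE; apply: eq_bigr => j _; rewrite mnmE. Qed.

Lemma big_blocks (R : Type) (idx : R) (op : Monoid.com_law idx)
    (E : 'I_(\sum_i n i) -> R) :
  \big[op/idx]_s E s =
  \big[op/idx]_i \big[op/idx]_(j < n i) E (tagnat.Rank i j).
Proof.
rewrite (reindex _ (@tagnat.rank_bij_on _ n)) /= sig_big_dep /=.
by apply: eq_bigr => p _; rewrite tagnat.rankE.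
Qed.

(** * Products of polynomials in disjoint variables *)

Section Polynomials.
Variable F : fieldType.
Implicit Types (h D : forall i, {mpoly F[n i]}).

HB.instance Definition _ (i : 'I_k) :=
  GRing.LRMorphism.copy (@block_inj F k n i)
   (fun p => p \mPo [tuple 'X_(tagnat.Rank i j) | j < n i]).

(** The finite index set over which a product of polynomials of bounded size
    expands into monomials. *)
Definition bounded_multinoms (K : nat) :=
  fprod (fun i => 'X_{1..(n i) < K} : finType).

Lemma eq_tensor_poly h1 h2 : (forall i, h1 i = h2 i) ->
  tensor_poly h1 = tensor_poly h2.
Proof. by move=> e; apply: eq_bigr => i _; rewrite e. Qed.

Lemma tensor_polyX mu :
  tensor_poly (fun i => 'X_[mu i]) = 'X_[glue mu] :> {mpoly F[_]}.
Proof.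
rewrite [RHS]mpolyXE_id big_blocks; apply: eq_bigr => i _.
rewrite /block_inj comp_mpolyX; apply: eq_bigr => j _.
by rewrite tnth_mktuple glue_Rank.
Qed.

Lemma tensor_polyD1 h i :
  tensor_poly h = block_inj (h i) * \prod_(j | j != i) block_inj (h j).
Proof. exact: bigD1. Qed.

Lemma tensor_poly1 : tensor_poly (fun i => 1 : {mpoly F[n i]}) = 1.
Proof. by apply: big1 => i _; rewrite rmorph1. Qed.

Lemma block_injE i (g : {mpoly F[n i]}) :
  block_inj g = tensor_poly (dfwith (fun j => 1 : {mpoly F[n j]}) g).
Proof.
rewrite (tensor_polyD1 _ i) dfwith_in [X in _ * X]big1 ?mulr1 // => j ne.
by rewrite dfwith_out 1?eq_sym // rmorph1.
Qed.

Lemma tensor_polyM h1 h2 :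
  tensor_poly h1 * tensor_poly h2 = tensor_poly (fun i => h1 i * h2 i).
Proof. by rewrite -big_split; apply: eq_bigr => i _; rewrite rmorphM. Qed.

(** The factors live in different rings, so the expansion of the product runs
    over dependent choices of one term in each factor. *)
Lemma tensor_poly_sum (T : 'I_k -> finType) (c : forall i, T i -> F)
    (g : forall i, T i -> {mpoly F[n i]}) :
  tensor_poly (fun i => \sum_j c i j *: g i j) =
  \sum_(p : fprod T) (\prod_i c i (p i)) *: tensor_poly (fun i => g i (p i)).
Proof.
transitivity (\prod_i \sum_j c i j *: block_inj (g i j)).
  apply: eq_bigr => i _; rewrite raddf_sum.
  by apply: eq_bigr => j _; apply: linearZ.
by rewrite prod_sum_fprod; apply: eq_bigr => p _; rewrite scaler_prod.
Qed.

Lemma tensor_poly_bounded K h : (forall i, msize (h i) <= K)%N ->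
  tensor_poly h =
  \sum_(p : bounded_multinoms K)
     (\prod_i (h i)@_(p i)) *: 'X_[glue (fun i => p i)].
Proof.
move=> hK; under eq_tensor_poly => i do rewrite [h i](mpolywE (hK i)).
rewrite (@tensor_poly_sum (fun i => 'X_{1..(n i) < K})
  (fun i (a : 'X_{1..(n i) < K}) => (h i)@_a) (fun i a => 'X_[a])).
by apply: eq_bigr => p _; rewrite -tensor_polyX.
Qed.

(** A monomial arises from exactly one choice of monomials in the factors,
    namely its own slices. *)
Lemma mcoeff_tensor_poly h m :
  (tensor_poly h)@_m = \prod_i (h i)@_(slice m i).
Proof.
(* K exceeds the degrees of the slices of m, so that they are index values. *)
pose K := maxn (mdeg m).+1 (\max_i msize (h i)).
have hK i : (msize (h i) <= K)%N.
  by rewrite leq_max [X in _ || X](leq_bigmax i) orbT.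
have mK i : (mdeg (slice m i) < K)%N.
  rewrite leq_max ltnS; apply/orP; left; rewrite mdeg_slice [mdeg m]mdegE.
  by rewrite big_blocks (bigD1 i) //= leq_addr.
rewrite (tensor_poly_bounded hK) raddf_sum /=.
pose p0 : bounded_multinoms K := [fprod i => BMultinom (mK i)].
have p0E i : p0 i = BMultinom (mK i) by rewrite fprodE.
rewrite (bigD1 p0) //= [X in _ + X]big1 => [|p ne].
  have -> : glue (fun i => p0 i) = m.
    rewrite -[RHS]sliceK; apply/mnmP => s; rewrite !mnmE p0E.
    by rewrite !mnmE.
  rewrite addr0 mcoeffZ mcoeffX eqxx mulr1.
  by apply: eq_bigr => i _; rewrite p0E.
rewrite mcoeffZ mcoeffX; case: eqP => [e|]; last by rewrite mulr0.
case/negP: ne; apply/eqP/fprodP => i; apply/val_inj.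
by rewrite p0E /= -e glueK.
Qed.

(** Both sides are multilinear in D, and for monomials D the coefficients of
    both sides factor through the blocks: those of the iterated derivative by
    the falling factorials, those of the product by [mcoeff_tensor_poly]. *)
Lemma diffop_tensor_poly D h :
  diffop (tensor_poly D) (tensor_poly h) =
  tensor_poly (fun i => diffop (D i) (h i)).
Proof.
pose K := \max_i msize (D i).
have DK i : (msize (D i) <= K)%N by apply: leq_bigmax.
apply/mpolyP => m; rewrite mcoeff_tensor_poly.
under [RHS]eq_bigr => i _ do rewrite (diffopwE _ (DK i)) raddf_sum /=.
rewrite prod_sum_fprod (tensor_poly_bounded DK) diffop_suml raddf_sum /=.
apply: eq_bigr => p _; rewrite diffopZl diffopXm mcoeffZ mcoeff_mderivm.
under [RHS]eq_bigr => i _ do rewrite mcoeffZ mcoeff_mderivm.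
rewrite [RHS]big_split /=; congr (_ * _).
rewrite mcoeff_tensor_poly big_blocks.
under [RHS]eq_bigr => i _ do rewrite -mulr_natr.
rewrite big_split /= -natr_prod mulr_natr; congr (_ *+ _).
  by apply: eq_bigr => i _; rewrite sliceD glueK.
apply: eq_bigr => i _; apply: eq_bigr => j _.
by rewrite !mnmDE glue_Rank mnmE.
Qed.

Lemma multihomog_tensor_poly e D :
  (forall i, D i \is (e i).-homog) -> multihomog e (tensor_poly D).
Proof.
move=> hD m; rewrite mcoeff_msupp mcoeff_tensor_poly => /prodf_neq0 h i.
by rewrite -mdeg_slice; apply: (dhomogP _ _ _ (hD i)); rewrite mcoeff_msupp h.
Qed.

Lemma multihomog_block_inj i d (g : {mpoly F[n i]}) : g \is d.-homog ->
  multihomog (fun j => if j == i then d else 0%N) (block_inj g).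
Proof.
move=> hg; rewrite block_injE; apply: multihomog_tensor_poly => j.
case: eqVneq => [->|ne]; first by rewrite dfwith_in.
by rewrite dfwith_out 1?eq_sym ?dhomog1.
Qed.

Lemma multihomogD e (P Q : {mpoly F[\sum_i n i]}) :
  multihomog e P -> multihomog e Q -> multihomog e (P + Q).
Proof.
by move=> hP hQ m /msuppD_le; rewrite mem_cat => /orP[/hP|/hQ].
Qed.

Lemma multihomog_sum e (I : Type) (r : seq I) (c : I -> F)
    (P : I -> {mpoly F[\sum_i n i]}) :
  (forall j, multihomog e (P j)) -> multihomog e (\sum_(j <- r) c j *: P j).
Proof.
move=> hP; apply: big_ind => [m|P1 P2|j _ m /msuppZ_le]; last exact: hP.
  by rewrite msupp0.
exact: multihomogD.
Qed.

End Polynomials.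
End Blocks.

(** * Linear independence of products *)

Section Freeness.
Variable F : fieldType.

(** The coefficients of a free family form a matrix with independent rows, and
    the columns of a right inverse give functionals dual to the family.  Being
    linear combinations of coefficients, these functionals can be multiplied
    across blocks of variables. *)
Lemma dual_mcoeff (n d K : nat) (g : 'I_d -> {mpoly F[n]}) :
    (forall j, msize (g j) <= K)%N ->
    (forall c : 'I_d -> F, \sum_j c j *: g j = 0 -> forall j, c j = 0) ->
  exists w : 'I_d -> 'X_{1..n < K} -> F,
    forall j l, \sum_(m : 'X_{1..n < K}) (g l)@_m * w j m = (l == j)%:R.
Proof.
move=> gK gfree; pose B : finType := 'X_{1..n < K}.
pose M : 'M[F]_(d, #|B|) := \matrix_(l, b) (g l)@_(enum_val b : B).
have Mfree : row_free M.
  apply: inj_row_free => v vM0; apply/rowP => j; rewrite mxE.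
  apply: (gfree (fun j => v 0 j)); apply/mpolyP => m.
  rewrite mcoeff0 raddf_sum /=.
  under eq_bigr => l _ do rewrite mcoeffZ.
  case: (ltnP (mdeg m) K) => hm; last first.
    rewrite big1 // => l _.
    by rewrite memN_msupp_eq0 ?mulr0 // msize_mdeg_ge // (leq_trans (gK l)).
  have /rowP/(_ (enum_rank (BMultinom hm : B))) := vM0.
  rewrite !mxE => {2}<-; apply: eq_bigr => l _.
  by rewrite mxE enum_rankK.
exists (fun j b => pinvmx M (enum_rank (b : B)) j) => j l.
have /matrixP/(_ l j) := mulmxVp Mfree; rewrite !mxE => <-.
rewrite [RHS](reindex (enum_rank : B -> _)); last first.
  by apply: onW_bij; apply: enum_rank_bij.
by apply: eq_bigr => b _; rewrite [M _ _]mxE enum_rankK.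
Qed.

(** The products of the functionals dual to the families [g i] are dual to the
    family of products. *)
Lemma tensor_poly_free (k : nat) (n d : 'I_k -> nat)
    (g : forall i, 'I_(d i) -> {mpoly F[n i]})
    (x : fprod (fun i => 'I_(d i)) -> F) :
    (forall i (c : 'I_(d i) -> F), \sum_j c j *: g i j = 0 ->
      forall j, c j = 0) ->
    \sum_p x p *: tensor_poly (fun i => g i (p i)) = 0 ->
  forall q, x q = 0.
Proof.
move=> gfree x0 q; pose K := \max_i \max_j msize (g i j).
have gK i j : (msize (g i j) <= K)%N.
  apply: leq_trans (leq_bigmax i).
  exact: (leq_bigmax (F := fun j => msize (g i j))).
have /fin_all_exists[w wE] i := dual_mcoeff (gK i) (@gfree i).
(* The product of the functionals dual to the g i (q i): it is 1 on the
   product with index q and 0 on the others. *)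
pose L (P : {mpoly F[\sum_i n i]}) : F :=
  \sum_(b : bounded_multinoms n K)
    P@_(glue (fun i => b i)) * \prod_i w i (q i) (b i).
have L0 : L 0 = 0 by apply: big1 => b _; rewrite mcoeff0 mul0r.
have LE : L (\sum_p x p *: tensor_poly (fun i => g i (p i))) =
    \sum_p x p * \prod_i (p i == q i)%:R.
  transitivity (\sum_(b : bounded_multinoms n K) \sum_p
      x p * (tensor_poly (fun i => g i (p i)))@_(glue (fun i => b i)) *
      \prod_i w i (q i) (b i)).
    apply: eq_bigr => b _; rewrite raddf_sum mulr_suml.
    by apply: eq_bigr => p _; rewrite /= mcoeffZ.
  rewrite exchange_big /=; apply: eq_bigr => p _.
  under [X in _ = _ * X]eq_bigr => i _ do rewrite -wE.
  rewrite prod_sum_fprod mulr_sumr; apply: eq_bigr => b _.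
  rewrite -mulrA mcoeff_tensor_poly -big_split /=; congr (_ * _).
  by apply: eq_bigr => i _; rewrite glueK.
rewrite -L0 -x0 LE (bigD1 q) //= [X in _ + X]big1 => [|p ne].
  by rewrite addr0 big1 ?mulr1 // => i _; rewrite eqxx.
have [i /negbTE pqi] : exists i, p i != q i.
  apply/existsP; rewrite -negb_forall; apply: contraNN ne => /forallP h.
  by apply/eqP/fprodP => i; apply/eqP.
by rewrite (bigD1 i) //= pqi mul0r mulr0.
Qed.

End Freeness.

(** * The apolar algebra of a product *)

Section Apolar.
Variables (F : fieldType) (m : nat) (s : {mpoly F[m]}).

Lemma apolar_classM (D E : {mpoly F[m]}) :
  apolar_class s (D * E) =
  ((apolar_class s D : apolar_algebra s) * apolar_class s E)%FA.
Proof. exact/esym/apolar_mulE. Qed.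

Lemma apolar_is_ideal :
  is_ideal (fun D => diffop D s = 0).
Proof.
split=> [|D E D0 E0|D E E0]; first exact: diffop0l.
  by rewrite diffopDl D0 E0 addr0.
by rewrite diffopM E0 linear0.
Qed.

End Apolar.

Section TensorApolar.
Variables (F : fieldType) (k : nat) (n : 'I_k -> nat).
Variable f : forall i, {mpoly F[n i]}.

Local Notation t := (tensor_poly f).
Local Notation A := (apolar_algebra t).
Local Notation Af := (fun i => apolar_algebra (f i)).
Local Notation T := (tensor_algebra Af).
Local Notation S := {mpoly F[\sum_i n i]}.
Local Notation cl i := (apolar_class (f i)).

(** This makes D_1 (x) ... (x) D_k |-> D_1 ... D_k well defined on classes. *)
Lemma tensor_poly_class (D E : forall i, {mpoly F[n i]}) :
  (forall i, cl i (D i) = cl i (E i)) ->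
  apolar_class t (tensor_poly D) = apolar_class t (tensor_poly E).
Proof.
move=> DE; apply/apolar_class_eq; rewrite !diffop_tensor_poly.
by apply: eq_tensor_poly => i; apply/apolar_class_eq.
Qed.

Definition basis_lift (p : tensor_index Af) (i : 'I_k) : {mpoly F[n i]} :=
  apolar_repr (basis_vec p i).

Definition lift (x : T) : S := \sum_p x p *: tensor_poly (basis_lift p).

(** Unlike [apolar_repr], this section of the class map is linear, which makes
    [lift] send pure tensors to products ([lift_pure]). *)
Definition lin_repr (i : 'I_k) (a : Af i) : {mpoly F[n i]} :=
  \sum_j coord (vbasis {:Af i}) j a *: apolar_repr (vbasis {:Af i})`_j.

Lemma lin_reprK i : cancel (@lin_repr i) (cl i).
Proof.
move=> a; rewrite linear_sum [RHS](coord_vbasis (memvf a)).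
by apply: eq_bigr => j _; rewrite linearZ /= apolar_reprK.
Qed.

Lemma lift_pure (a : forall i, Af i) :
  lift (pure_tensor a) = tensor_poly (fun i => lin_repr (a i)).
Proof.
rewrite (tensor_poly_sum (fun i j => coord (vbasis {:Af i}) j (a i))
  (fun i j => apolar_repr (vbasis {:Af i})`_j)).
by apply: eq_bigr => p _; rewrite ffunE.
Qed.

Lemma lift_linear : linear lift.
Proof.
move=> c x y; rewrite /lift scaler_sumr -big_split; apply: eq_bigr => p _.
by rewrite !ffunE scalerDl scalerA.
Qed.

HB.instance Definition _ := GRing.isLinear.Build F T S _ lift lift_linear.

Definition of_tensor (x : T) : A := apolar_class t (lift x).

HB.instance Definition _ :=
  GRing.Linear.copy of_tensor (apolar_class t \o lift).

Lemma of_tensor_pure (D : forall i, {mpoly F[n i]}) :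
  of_tensor (pure_tensor (fun i => cl i (D i) : Af i)) =
  apolar_class t (tensor_poly D).
Proof.
rewrite /of_tensor lift_pure; apply: tensor_poly_class => i.
by rewrite lin_reprK.
Qed.

(** The derivatives of f_i by representatives of a basis of A_{f_i} are
    linearly independent, and so are their products. *)
Lemma lift_inj (x : T) : diffop (lift x) t = 0 -> x = 0.
Proof.
pose g i j := diffop (apolar_repr (vbasis {:Af i})`_j) (f i).
rewrite diffop_suml => x0; apply/ffunP => q; rewrite ffunE.
apply: (tensor_poly_free (g := g)) => [i c c0|]; last first.
  rewrite -[RHS]x0; apply: eq_bigr => p _.
  by rewrite diffopZl diffop_tensor_poly.
have /freeP := basis_free (vbasisP {:Af i}); apply.
rewrite -[RHS](linear0 (cl i)).
transitivity (cl i (\sum_j c j *: apolar_repr (vbasis {:Af i})`_j)).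
  by rewrite linear_sum; apply: eq_bigr => j _; rewrite linearZ /= apolar_reprK.
apply/apolar_class_eq; rewrite diffop0l -[RHS]c0 diffop_suml.
by apply: eq_bigr => j _; rewrite diffopZl.
Qed.

Lemma of_tensor_inj : injective of_tensor.
Proof.
move=> x y /apolar_class_eq exy; apply/eqP; rewrite -subr_eq0; apply/eqP.
by apply: lift_inj; rewrite raddfB diffopBl exy subrr.
Qed.

(** The preimage of the class of D under [of_tensor], written monomial by
    monomial. *)
Definition tensor_class (D : S) : T :=
  \sum_(m <- msupp D) D@_m *: pure_tensor (fun i => cl i 'X_[slice m i] : Af i).

(** A monomial is the product of its slices, and the lift of its class is a
    product whose factors agree with these slices modulo the f_i^perp.  The
    ideal J is arbitrary since the lemma serves twice: with t^perp for the
    surjectivity of [of_tensor], and with the ideal spanned by the generators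
    of small multidegree for [apolar_tensor_generated]. *)
Lemma sub_lift_tensor_class (J : S -> Prop) : is_ideal J ->
    (forall i g, diffop g (f i) = 0 -> J (block_inj g)) ->
  forall D, J (D - lift (tensor_class D)).
Proof.
move=> idJ Jf D; rewrite {1}[D]mpolyE (linear_sum lift) -sumrB.
apply: ideal_sum => // m _; rewrite (linearZ_LR lift) -scalerBr -mul_mpolyC.
have [_ _ JM] := idJ; apply: JM.
rewrite /= lift_pure -{1}[m]sliceK -tensor_polyX; apply: ideal_prod_sub => // i.
rewrite -raddfB; apply: Jf; rewrite diffopBl; apply/eqP; rewrite subr_eq0.
by apply/eqP/apolar_class_eq; rewrite lin_reprK.
Qed.

Lemma apolar_block_inj i g : diffop g (f i) = 0 -> diffop (block_inj g) t = 0.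
Proof.
move=> g0.
rewrite block_injE diffop_tensor_poly (tensor_polyD1 _ i) dfwith_in g0.
by rewrite raddf0 mul0r.
Qed.

Lemma of_tensor_class D : of_tensor (tensor_class D) = apolar_class t D.
Proof.
apply/esym/apolar_class_eq/eqP; rewrite -subr_eq0 -diffopBl; apply/eqP.
exact: (sub_lift_tensor_class (apolar_is_ideal t) apolar_block_inj).
Qed.

Definition to_tensor (x : A) : T := tensor_class (apolar_repr x).

Lemma to_tensorK : cancel to_tensor of_tensor.
Proof.
by move=> x; rewrite /to_tensor of_tensor_class; apply: apolar_reprK.
Qed.

Lemma of_tensorK : cancel of_tensor to_tensor.
Proof. exact: inj_can_sym to_tensorK of_tensor_inj. Qed.

HB.instance Definition _ := GRing.isLinear.Build F A T _ to_tensor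
  (can2_linear of_tensorK to_tensorK).

Lemma of_tensor1 : of_tensor 1%FA = 1%FA.
Proof.
rewrite [RHS](_ : _ = apolar_class t (tensor_poly (fun i => 1))).
  by rewrite of_tensor_pure.
by rewrite tensor_poly1.
Qed.

Lemma of_tensorM x y : of_tensor (x * y)%FA = (of_tensor x * of_tensor y)%FA.
Proof.
rewrite -apolar_classM /lift big_distrlr !linear_sum /=; apply: eq_bigr => p _.
rewrite !linear_sum /=; apply: eq_bigr => q _.
rewrite -scalerAl -scalerAr scalerA !linearZ /= tensor_polyM; congr (_ *: _).
by rewrite -of_tensor_pure.
Qed.

(** From left to right, the monomials of a multihomogeneous D have slices of
    the prescribed degrees.  From right to left, pure tensors of classes of
    homogeneous operators come from multihomogeneous products. *)
Lemma to_tensor_graded e x :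
  apolar_multipiece t e x <->
  tensor_piece (A := Af) (fun i => apolar_piece (f i) (e i)) (to_tensor x).
Proof.
split=> [[D [hD ->]]|[r [c [a [ha xE]]]]].
  rewrite -of_tensor_class of_tensorK /tensor_class.
  rewrite (big_nth 0%MM) big_mkord.
  pose m (j : 'I_(size (msupp D))) := nth 0%MM (msupp D) j.
  exists _, (fun j => D@_(m j)), (fun j i => cl i 'X_[slice (m j) i]).
  split=> // j i; exists 'X_[slice (m j) i]; split=> //.
  by rewrite dhomogX /= mdeg_slice; apply/eqP/hD/mem_nth.
have /fin_all_exists[D hD] j :
    exists D, multihomog e D /\
      of_tensor (pure_tensor (a j)) = apolar_class t D.
  have /fin_all_exists[D hD] := ha j.
  exists (tensor_poly D); split.
    by apply: multihomog_tensor_poly => i; case: (hD i).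
  rewrite -of_tensor_pure; congr of_tensor.
  by apply: eq_pure_tensor => i; case: (hD i).
exists (\sum_j c j *: D j); split.
  by apply: multihomog_sum => j; case: (hD j).
rewrite -[x]to_tensorK xE !linear_sum /=; apply: eq_bigr => j _.
by rewrite !linearZ /=; case: (hD j) => _ ->.
Qed.

Lemma graded_alg_iso_apolar_tensor :
  graded_alg_iso (apolar_multipiece t)
    (fun e : 'I_k -> nat =>
       tensor_piece (A := Af) (fun i => apolar_piece (f i) (e i))) to_tensor.
Proof.
split=> [||x y|e x]; last exact: to_tensor_graded.
- by exists of_tensor; [apply: to_tensorK | apply: of_tensorK].
- by apply: of_tensor_inj; rewrite to_tensorK of_tensor1.
by apply: of_tensor_inj; rewrite of_tensorM !to_tensorK.
Qed.

Lemma dim_apolar_tensor : \dim {: A} = (\prod_i \dim {: Af i})%N.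
Proof.
have -> : \dim {: A} = \dim {: T}.
  have linphiE : linfun to_tensor =1 to_tensor by move=> x; rewrite lfunE.
  have lker0 : lker (linfun to_tensor) == 0%VS.
    by apply/lker0P => x y; rewrite !linphiE => /(can_inj to_tensorK).
  rewrite -(limg_dim_eq (f := linfun to_tensor)) ?(eqP lker0) ?capv0 //.
  congr (\dim _); apply/eqP; rewrite eqEsubv subvf; apply/subvP => y _.
  by rewrite -[y]of_tensorK -linphiE memv_img ?memvf.
(* The space of functions from an index set to F has dimension the size of
   that set times 1. *)
rewrite dimvf; transitivity #|tensor_index Af|; first exact: muln1.
by rewrite card_fprod; apply: eq_bigr => i _; rewrite card_ord.
Qed.

(** The generating set is taken as large as possible, which avoids choosing
    generators of each f_i^perp; the ideal that it spans contains every
    f_i^perp, hence t^perp by [sub_lift_tensor_class]. *)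
Lemma apolar_tensor_generated (delta : 'I_k -> nat) :
  (forall i, generated_within (apolar (f i)) (deg_le (delta i))) ->
  generated_within (apolar t) (multideg_le delta).
Proof.
move=> hf; pose G D := multideg_le delta D /\ diffop D t = 0.
have idG : is_ideal (ideal_span G) by apply: ideal_span_is_ideal.
exists G; split=> [D []//|D]; rewrite inE; split=> [/eqP D0|]; last first.
  move=> GD; apply/eqP; move: D GD.
  by apply: ideal_span_min (apolar_is_ideal t) _ => D [].
(* D minus the lift of its class, which is 0 as D(t) = 0. *)
rewrite -[D]subr0 -[0](linear0 lift) -(_ : tensor_class D = 0).
  apply: sub_lift_tensor_class => // i g g0; have [Gi [Gi_deg Gi_gen]] := hf i.
  have /Gi_gen[r [c [h [Gih ->]]]] : g \in apolar (f i) by rewrite inE g0.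
  rewrite raddf_sum; apply: ideal_sum => // j _; rewrite /= rmorphM.
  have [_ _ JM] := idG; apply/JM/ideal_span_gen; split; last first.
    apply: apolar_block_inj; apply/eqP.
    rewrite -[_ == _]/(h j \in apolar (f i)); apply/Gi_gen.
    exact: ideal_span_gen.
  have [d [le_d hd]] := Gi_deg _ (Gih j).
  exists (fun l => if l == i then d else 0%N); split=> [l|].
    by case: eqP => // ->.
  exact: multihomog_block_inj.
apply: of_tensor_inj; rewrite of_tensor_class linear0.
rewrite -(linear0 (apolar_class t)).
by apply/apolar_class_eq; rewrite diffop0l.
Qed.

End TensorApolar.

Theorem proposition3p2 (R : realType) (k : nat) (V : 'I_k -> vectType R[i])
    (d : 'I_k -> nat) (f : forall i : 'I_k, Sym (V i))
    (hf : forall i, f i \is (d i).-homog) :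
  let t := tensor_poly f in
  let A := apolar_algebra t in
  let Af := fun i => apolar_algebra (f i) in
  [/\ exists phi : {linear A -> tensor_algebra Af},
        graded_alg_iso
          (apolar_multipiece t)
          (fun e : 'I_k -> nat =>
             tensor_piece (A := Af) (fun i => apolar_piece (f i) (e i)))
          phi,
      \dim {: A} = (\prod_i \dim {: Af i})%N
    & forall delta : 'I_k -> nat,
        (forall i, generated_within (apolar (f i)) (deg_le (delta i))) ->
        generated_within (apolar t) (multideg_le delta)].
Proof.
split; [|exact: dim_apolar_tensor|exact: apolar_tensor_generated].
by exists (@to_tensor _ _ _ f); apply: graded_alg_iso_apolar_tensor.
Qed.
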